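(* Let $\mathbb O$ be a growth class, and let $\mathfrak{Dim}$ be one of the dimension functions $\mathrm{Dim}$, $\mathrm{Dim}^d$ and $\mathrm{CDim}$. Let $\phi=\phi(\vec x)$ and $\psi=\psi(\vec x)$ be formulas of some logic $\mathcal L$ with team semantics. (a) If $\mathfrak{Dim}_{\phi,\vec x},\mathfrak{Dim}_{\psi,\vec x}\in\mathbb O$, then $\mathfrak{Dim}_{\phi\land\psi,\vec x}\in\mathbb O$. (b) If $\mathfrak{Dim}_{\phi,\vec x},\mathfrak{Dim}_{\psi,\vec x}\in\mathbb O$, then $\mathfrak{Dim}_{\phi\lor\psi,\vec x}\in\mathbb O$. (c) If $\mathfrak{Dim}_{\phi,\vec x}\in\mathbb O$, then $\mathfrak{Dim}_{\exists x_i\phi,\vec x^-}\in\mathbb O$ and $\mathfrak{Dim}_{\forall x_i\phi,\vec x^-}\in\mathbb O$, where $\vec x^-$ is $\vec x$ without the component $x_i$. (d) If $Q_{\mathcal K}$ is a Lindström quantifier, $\vec x=\vec z\otimes_{\vec\ell}\vec y$ and $\mathfrak{Dim}_{\phi,\vec x}\in\mathbb O$, then $\mathfrak{Dim}_{Q_{\mathcal K}\vec y\,\phi,\vec z}\in\mathbb O$.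
   Context: Models are assumed to have at least two elements. $[A,B]=\{C:A\subseteq C\subseteq B\}$. A family of sets $\mathcal A$ is an interval if $\mathcal A=[A_0,A_1]$ with $A_0\subseteq A_1$; convex if $[S,T]\subseteq\mathcal A$ for all $S,T\in\mathcal A$; dominated if $\bigcup\mathcal A\in\mathcal A$; supported if it is nonempty and $\bigcap\mathcal A\in\mathcal A$. A subfamily $\mathcal G\subseteq\mathcal A$ dominates $\mathcal A$ if there are dominated convex families $\mathcal D_G$ ($G\in\mathcal G$) with $\bigcup_{G\in\mathcal G}\mathcal D_G=\mathcal A$ and $\bigcup\mathcal D_G=G$ for each $G$; $\mathcal K\subseteq\mathcal A$ supports $\mathcal A$ if there are supported convex families $\mathcal S_K$ ($K\in\mathcal K$) with $\bigcup_{K\in\mathcal K}\mathcal S_K=\mathcal A$ and $\bigcap\mathcal S_K=K$ for each $K$. Upper dimension: $\mathrm D(\mathcal A)=\min\{|\mathcal G|:\mathcal G\text{ dominates }\mathcal A\}$; dual upper dimension: $\mathrm D^d(\mathcal A)=\min\{|\mathcal G|:\mathcal G\text{ supports }\mathcal A\}$; cylindrical dimension: $\mathrm{CD}(\mathcal A)$ is the least $|I|$ such that $\mathcal A=\bigcup_{i\in I}\mathcal A_i$ with each $\mathcal A_i$ an interval. A team in a model $M$ with domain $\vec x=(x_0,\dots,x_{m-1})$ (distinct variables) is a set of assignments of $\vec x$ into $M$, identified with a subset of $M^m$. For a formula $\phi$ with free variables in $\vec x$, $\|\phi\|^{M,\vec x}=\{T\subseteq M^m: M\models_T\phi\}$.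 $\mathrm{Dim}_{\phi,\vec x}(n)$, $\mathrm{Dim}^d_{\phi,\vec x}(n)$, $\mathrm{CDim}_{\phi,\vec x}(n)$ denote the suprema of $\mathrm D(\|\phi\|^{M,\vec x})$, $\mathrm D^d(\|\phi\|^{M,\vec x})$, $\mathrm{CD}(\|\phi\|^{M,\vec x})$, respectively, over models $M$ with $|M|=n$. A growth class is a set $\mathbb O$ of functions $\mathbb N\to\mathbb N$ such that if $g\in\mathbb O$ and $f\le g$ pointwise then $f\in\mathbb O$, and if $f,g\in\mathbb O$ then $f+g\in\mathbb O$ and $fg\in\mathbb O$ (pointwise operations). Team semantics: $M\models_T\phi\wedge\psi$ iff $M\models_T\phi$ and $M\models_T\psi$. $M\models_T\phi\vee\psi$ iff $T=U\cup V$ with $M\models_U\phi$, $M\models_V\psi$ for some $U,V$. $M\models_T\exists x\phi$ iff there is $F:T\to\mathcal P(M)\setminus\{\emptyset\}$ with $M\models_{T[F/x]}\phi$, $T[F/x]=\{s(a/x):s\in T,a\in F(s)\}$. $M\models_T\forall x\phi$ iff $M\models_{T[M/x]}\phi$, $T[M/x]=\{s(a/x):s\in T,a\in M\}$. A Lindström quantifier $Q_{\mathcal K}$ of type $(r)$, $r\ge1$, is given by an isomorphism-closed class $\mathcal K$ of structures $(A,R)$ with $R\subseteq A^r$: $M\models_T Q_{\mathcal K}\vec y\,\psi$ iff there is $F:T\to\mathcal P(M^r)$ with $M\models_{T[F/\vec y]}\psi$ and $(M,F(s))\in\mathcal K$ for all $s\in T$, where $T[F/\vec y]=\{s(\vec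 b/\vec y):s\in T,\vec b\in F(s)\}$. $\vec x=\vec z\otimes_{\vec\ell}\vec y$ means that $\vec x$ is the tuple obtained by shuffling $\vec z$ and $\vec y$ according to $\vec\ell=(\ell_0,\dots,\ell_{r-1})$ (distinct indices): $y_i=x_{\ell_i}$ for $i<r$, and $\vec z$ lists the remaining variables of $\vec x$ in ascending order of index. *)

(* Defs.v *)
From HB Require Import structures.
From mathcomp Require Import boolp classical_sets.
From mathcomp Require Import all_boot all_order finmap.

Set Implicit Arguments.
Unset Strict Implicit.
Unset Printing Implicit Defensive.

Section Families.
Variable X : finType.
Implicit Types (A B K : {set X}) (F G : {set {set X}}).

Definition set_itv A B : {set {set X}} :=
  [set C : {set X} | (A \subset C) && (C \subset B)]%SET.

Definition is_interval F : bool :=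
  [exists A : {set X}, exists B : {set X}, (A \subset B) && (F == set_itv A B)].

Definition convex_family F : bool :=
  [forall A in F, forall B in F, set_itv A B \subset F].

Definition dominated F : bool := cover F \in F.

Definition supported F : bool :=
  (F != set0) && ((\bigcap_(A in F) A)%SET \in F).

Definition dominates G F : bool :=
  (G \subset F) &&
  [exists D : {ffun {set X} -> {set {set X}}},
    [forall A in G, [&& dominated (D A), convex_family (D A) & cover (D A) == A]]
    && ((\bigcup_(A in G) D A)%SET == F)].

Definition supports G F : bool :=
  (G \subset F) &&
  [exists S : {ffun {set X} -> {set {set X}}},
    [forall K in G, [&& supported (S K), convex_family (S K)
                      & (\bigcap_(A in S K) A)%SET == K]]
    && ((\bigcup_(K in G) S K)%SET == F)].

Definition cylindrical_cover (k : nat) F : bool :=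
  [exists I : {ffun 'I_k -> {set {set X}}},
    [forall i, is_interval (I i)] && (F == (\bigcup_i I i)%SET)].

Lemma set_itvxx A : set_itv A A = [set A]%SET.
Proof.
by apply/setP => C; rewrite !inE eq_sym eqEsubset.
Qed.

Lemma convex_family1 A : convex_family [set A]%SET.
Proof.
apply/forall_inP => B /set1P ->; apply/forall_inP => C /set1P ->.
by rewrite set_itvxx.
Qed.

Lemma dominates_refl F : dominates F F.
Proof.
rewrite /dominates subxx /=; apply/existsP; exists [ffun A => [set A]%SET].
apply/andP; split.
  apply/forall_inP => A _; rewrite ffunE convex_family1 /dominated.
  by rewrite /cover big_set1 inE eqxx.
apply/eqP/setP => A; apply/bigcupP/idP => [[B BF]|AF].
  by rewrite ffunE => /set1P ->.
by exists A => //; rewrite ffunE inE.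
Qed.

Lemma supports_refl F : supports F F.
Proof.
rewrite /supports subxx /=; apply/existsP; exists [ffun A => [set A]%SET].
apply/andP; split.
  apply/forall_inP => A _; rewrite ffunE convex_family1 /supported.
  rewrite big_set1 inE !eqxx !andbT; apply/set0Pn; exists A.
  by rewrite inE.
apply/eqP/setP => A; apply/bigcupP/idP => [[B BF]|AF].
  by rewrite ffunE => /set1P ->.
by exists A => //; rewrite ffunE inE.
Qed.

Lemma cylindrical_cover_card F : cylindrical_cover #|F| F.
Proof.
apply/existsP; exists [ffun i => [set enum_val i]%SET].
apply/andP; split.
  apply/forallP => i; rewrite ffunE; apply/existsP; exists (enum_val i).
  by apply/existsP; exists (enum_val i); rewrite subxx set_itvxx eqxx.
apply/eqP/setP => A; apply/idP/bigcupP => [AF|[i _]].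
  by exists (enum_rank_in AF A) => //; rewrite ffunE enum_rankK_in // inE.
by rewrite ffunE => /set1P ->; exact: enum_valP.
Qed.

Lemma cylindrical_cover_exists F : exists k, cylindrical_cover k F.
Proof. by exists #|F|; exact: cylindrical_cover_card. Qed.

(* [F] dominates and supports itself, so the default value of [arg min] is
   never returned by accident. *)
Definition upper_dim F : nat := #|[arg min_(G < F | dominates G F) #|G|]|.
Definition dual_upper_dim F : nat := #|[arg min_(G < F | supports G F) #|G|]|.
Definition cylindrical_dim F : nat := ex_minn (cylindrical_cover_exists F).

End Families.

Inductive dim_kind := Upper | DualUpper | Cylindrical.

Definition dim (d : dim_kind) (X : finType) (F : {set {set X}}) : nat :=
  match d with
  | Upper => upper_dim F
  | DualUpper => dual_upper_dim F
  | Cylindrical => cylindrical_dim F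
  end.

Lemma dim_le_card d (X : finType) (F : {set {set X}}) : dim d F <= #|F|.
Proof.
case: d; rewrite /= /upper_dim /dual_upper_dim /cylindrical_dim.
- by case: arg_minnP => [|G _ ->//]; exact: dominates_refl.
- by case: arg_minnP => [|G _ ->//]; exact: supports_refl.
- by case: ex_minnP => k _; apply; exact: cylindrical_cover_card.
Qed.

(* The dimension functions at [n] only see the models with exactly [n]
   elements, so all models are taken to be finite. *)

Record vocabulary := Vocabulary {
  rel_symbol : Type;
  rel_arity : rel_symbol -> nat;
  fun_symbol : Type;
  fun_arity : fun_symbol -> nat }.

Record model (tau : vocabulary) := Model {
  carrier :> finType;
  rel_interp : forall R : rel_symbol tau, {set (rel_arity R).-tuple carrier};
  fun_interp : forall f : fun_symbol tau, (fun_arity f).-tuple carrier -> carrier;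
  card_carrier : 1 < #|carrier| }.

Notation assignment A := {fmap nat -> A}.
Notation team A := {fset {fmap nat -> A}}.

(* s(b/y); for [y] with distinct entries the order of the updates is
   irrelevant *)
Definition update (A : Type) (s : assignment A) (y : seq nat) (b : seq A) :
    assignment A :=
  foldr (fun (p : nat * A) (s' : assignment A) => s'.[p.1 <- p.2]%fmap)
        s (zip y b).

(* the team with domain [x] identified with [T], a subset of [A ^ size x] *)
Definition team_of (A : finType) (x : seq nat) (T : {set (size x).-tuple A}) :
    team A :=
  [fset update [fmap]%fmap x t | t : (size x).-tuple A in T]%fset.

Definition supplement (A : finType) (r : nat) (T : team A)
    (F : assignment A -> {set r.-tuple A}) (y : r.-tuple nat) : team A :=
  [fset update s y b | s : assignment A in T, b : r.-tuple A in F s]%fset.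

Definition supplement1 (A : finType) (T : team A)
    (F : assignment A -> {set A}) (v : nat) : team A :=
  [fset (s.[v <- a])%fmap | s : assignment A in T, a : A in F s]%fset.

Definition duplicate (A : finType) (T : team A) (v : nat) : team A :=
  supplement1 T (fun=> setT) v.

Record team_logic (tau : vocabulary) := TeamLogic {
  base_formula : Type;
  base_fv : base_formula -> {fset nat};
  base_sat : forall M : model tau, team M -> base_formula -> Prop }.

Record lindstrom := Lindstrom {
  arity : nat;
  arity_gt0 : 0 < arity;
  lclass : forall A : finType, {set arity.-tuple A} -> Prop;
  lclass_iso : forall (A B : finType) (f : A -> B) (R : {set arity.-tuple A}),
    bijective f ->
    (lclass R <-> lclass [set map_tuple f t | t in R]%SET) }.

(* An arbitrary logic [L] closed under the logical operations; on [Base] the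
   semantics is that of [L]. *)
Inductive formula (tau : vocabulary) (L : team_logic tau) : Type :=
| Base of base_formula L
| And of formula L & formula L
| Or of formula L & formula L
| Ex of nat & formula L
| All of nat & formula L
| Lind (Q : lindstrom) of (arity Q).-tuple nat & formula L.

Section Semantics.
Variables (tau : vocabulary) (L : team_logic tau).

Fixpoint fv (phi : formula L) : {fset nat} :=
  match phi with
  | Base p => base_fv p
  | And p q | Or p q => (fv p `|` fv q)%fset
  | Ex v p | All v p => (fv p `\ v)%fset
  | Lind Q y p => (fv p `\` [fset v in tval y])%fset
  end.

Fixpoint sat (M : model tau) (T : team M) (phi : formula L) : Prop :=
  match phi with
  | Base p => base_sat T p
  | And p q => sat T p /\ sat T q
  | Or p q => exists U V : team M, [/\ T = (U `|` V)%fset, sat U p & sat V q]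
  | Ex v p => exists F : assignment M -> {set M},
      (forall s, s \in T -> F s != set0) /\ sat (supplement1 T F v) p
  | All v p => sat (duplicate T v) p
  | Lind Q y p => exists F : assignment M -> {set (arity Q).-tuple M},
      (forall s, s \in T -> lclass (F s)) /\ sat (supplement T F y) p
  end.

Definition extension (phi : formula L) (M : model tau) (x : seq nat) :
    {set {set (size x).-tuple M}} :=
  [set T : {set (size x).-tuple M} | `[< sat (team_of T) phi >]]%SET.

(* For n < 2 there is no model and the supremum is 0; for n >= 2 it is a
   genuine least upper bound, see [dim_fun_leP]. *)
Definition dim_fun (d : dim_kind) (phi : formula L) (x : seq nat) (n : nat) :
    nat :=
  supremum 0
    [set k | exists2 M : model tau,
       #|M| = n & dim d (extension phi M x) = k]%classic.

Lemma dim_fun_leP d phi x n k :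
  dim_fun d phi x n <= k <->
  forall M : model tau, #|M| = n -> dim d (extension phi M x) <= k.
Proof.
rewrite /dim_fun; set S := mkset _.
have bnd : ubound S (2 ^ (n ^ size x)).
  move=> _ [M nM <-]; rewrite -nM -card_tuple -cardsT -card_powerset.
  rewrite powersetT cardsT; apply: leq_trans (dim_le_card _ _) (max_card _).
have [S0|S0] := eqVneq S classical_sets.set0.
  rewrite S0 supremum0; split=> // _ M nM.
  have : S (dim d (extension phi M x)) by exists M.
  by rewrite S0.
have [m [ubm lem]] : exists m, supremums S m.
  have ex : exists m, `[< ubound S m >] by exists (2 ^ (n ^ size x)); apply/asboolP.
  case: (ex_minnP ex) => m /asboolP ubm lem; exists m; split=> // j ubj.
  by apply: lem; apply/asboolP.
have [ub le] : supremums S (supremum 0 S).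
  by rewrite /supremum (negPf S0); apply: xgetPex; exists m; split.
split=> [lek M nM|H]; last by apply: le => _ [M nM <-]; exact: H.
by apply: leq_trans lek; apply: ub; exists M.
Qed.

End Semantics.

Definition growth_class (O : set (nat -> nat)) : Prop :=
  [/\ forall f g, O g -> (forall n, f n <= g n) -> O f,
      forall f g, O f -> O g -> O (fun n => f n + g n)
    & forall f g, O f -> O g -> O (fun n => f n * g n)].

(* x is the shuffle of z and y according to l; 0 is an unused default. *)
Definition shuffle (x z l y : seq nat) : Prop :=
  [/\ uniq l, all (fun i => i < size x) l, y = [seq nth 0 x i | i <- l]
    & z = [seq nth 0 x i | i <- iota 0 (size x) & i \notin l]].

(* Main.v *)
Require Import Defs.
From HB Require Import structures.
From mathcomp Require Import boolp classical_sets.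
From mathcomp Require Import all_boot all_order finmap.

(** All three dimensions count pieces of one shape.  Call a family
join-convex if it contains every [C] with [S \subset C \subset S :|: T] for
members [S] and [T], and meet-convex if it contains every [C] with
[S :&: T \subset C \subset S].  On a finite set, the nonempty join-convex
families are the dominated convex ones, the nonempty meet-convex families are
the supported convex ones, and the nonempty families that are both are the
intervals.  Hence each of the three dimensions of a family is the least number
of such cells, empty ones permitted, whose union is the family ([dim_leP]).

The logical operations act on families through local operators.  For a map
[p : Y -> X] and, for each [u : X], a property [K u] of subsets of the fiber
of [p] over [u], [local_op p K F] is the family of the sets [T] that have a
witness [T'] in [F] lying over [T] such that the part of [T'] over each [u] in
[T] satisfies [K u].  As the condition is imposed fiber by fiber, witnesses can
be cut and glued along fibers: if [S \subset C \subset S :|: T] and [S'], [T']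
are witnesses for [S], [T], then adding to [S'] the part of [T'] over
[C :\: S] gives a witness for [C], which lies between [S'] and [S' :|: T'].
If [S :&: T \subset C \subset S], then the part of [S'] over [C] is a witness
for [C], which lies between [S' :&: T'] and [S'].  So local operators map
cells to cells; they also commute with unions, and therefore do not increase
dimension ([dim_local_op]).

Every quantifier is a local operator along the projection that forgets the
quantified variables: [K u] says that the fiber, a relation on the model,
belongs to the quantifier; the nonempty sets give the existential and the full
set gives the universal quantifier ([dim_quantifier_extension]).
Conjunction and disjunction are local operators, along the folding map
[X + X -> X], applied to the family of the disjoint sums of a member of the
first and a member of the second family; the dimension of that family is at
most the product of the two dimensions ([dim_sum_family]).  These bounds hold
in every model, so the dimension functions obey them pointwise, and a growth
class is closed under products and downward. *)

Set Implicit Arguments.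
Unset Strict Implicit.
Unset Printing Implicit Defensive.

(** * Dimensions as numbers of cells *)

Section Cells.
Variable X : finType.
Implicit Types (A B C S T : {set X}) (D F G : {set {set X}}).
Implicit Types P : {set {set {set X}}}.

(** Unlike a dominated convex family, a join-convex family may be empty, and
the definition does not mention its largest member. *)
Definition join_convex F := forall S T C, S \in F -> T \in F ->
  S \subset C -> C \subset S :|: T -> C \in F.

(** The order dual of [join_convex]. *)
Definition meet_convex F := forall S T C, S \in F -> T \in F ->
  S :&: T \subset C -> C \subset S -> C \in F.

(** The pieces counted by the dimension of kind [d], and the empty family. *)
Definition cell d F := match d with
  | Upper => join_convex F
  | DualUpper => meet_convex F
  | Cylindrical => join_convex F /\ meet_convex F
  end.

(** A maximal member absorbs every other member, as the family is closed under
binary unions. *)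
Lemma join_convex_cover F S :
  join_convex F -> S \in F -> cover F \in F.
Proof.
move=> jF SF; have [B mB _] := maxset_exists (P := mem F) SF.
have BF : B \in F := maxsetp mB.
suff -> : cover F = B by [].
apply/eqP; rewrite eqEsubset (bigcup_sup B) // andbT.
apply/bigcupsP => T TF; have eBT : B :|: T = B.
  apply: (maxsetsup mB) (subsetUl B T).
  by apply: (jF B T); rewrite ?subsetUl.
by rewrite -eBT subsetUr.
Qed.

Lemma meet_convex_bigcap F S :
  meet_convex F -> S \in F -> \bigcap_(A in F) A \in F.
Proof.
move=> mF SF; have [B mB _] := minset_exists (P := mem F) SF.
have BF : B \in F := minsetp mB.
suff -> : \bigcap_(A in F) A = B by [].
apply/eqP; rewrite eqEsubset (bigcap_inf B) //=.
apply/bigcapsP => T TF; have eBT : B :&: T = B.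
  apply: (minsetinf mB) (subsetIl B T).
  by apply: (mF B T); rewrite ?subsetIl.
by rewrite -eBT subsetIr.
Qed.

Lemma mem_set_itv A B C : (C \in set_itv A B) = (A \subset C) && (C \subset B).
Proof. by rewrite inE. Qed.

Lemma convex_familyP F : reflect
  (forall A B C, A \in F -> B \in F -> A \subset C -> C \subset B -> C \in F)
  (convex_family F).
Proof.
apply: (iffP idP) => [/forall_inP cF A B C AF BF AC CB|cF].
  have /forall_inP/(_ B BF)/subsetP := cF A AF.
  by apply; rewrite mem_set_itv AC.
apply/forall_inP => A AF; apply/forall_inP => B BF; apply/subsetP => C.
by rewrite mem_set_itv => /andP[]; apply: cF AF BF.
Qed.

Lemma convex_dominated_join_convex F :
  convex_family F -> dominated F -> join_convex F.
Proof.
move=> /convex_familyP cF dF S T C SF TF SC CST.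
apply: (cF S _ _ SF dF SC); apply: subset_trans CST _.
by rewrite subUset (bigcup_sup S) ?(bigcup_sup T).
Qed.

Lemma convex_supported_meet_convex F :
  convex_family F -> supported F -> meet_convex F.
Proof.
move=> /convex_familyP cF /andP[_ sF] S T C SF TF STC CS.
apply: (cF _ S _ sF SF _ CS); apply: subset_trans STC.
by rewrite subsetI (bigcap_inf S) ?(bigcap_inf T).
Qed.

Lemma interval_cell F : is_interval F -> join_convex F /\ meet_convex F.
Proof.
case/existsP=> A /existsP[B /andP[AB /eqP->]].
split=> S T C; rewrite !mem_set_itv => /andP[AS SB] /andP[AT TB] sub1 sub2.
  by rewrite (subset_trans AS sub1) (subset_trans sub2) // subUset SB.
by rewrite (subset_trans _ sub1) ?subsetI ?AS // (subset_trans sub2).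
Qed.

Lemma cell_interval F :
  F != set0 -> join_convex F -> meet_convex F -> is_interval F.
Proof.
case/set0Pn=> S SF jF mF; apply/existsP; exists (\bigcap_(A in F) A).
apply/existsP; exists (cover F); apply/andP; split.
  exact: subset_trans (bigcap_inf S SF) (bigcup_sup S SF).
apply/eqP/setP => C; rewrite mem_set_itv; apply/idP/andP => [CF|[sub1 sub2]].
  by rewrite (bigcap_inf C) ?(bigcup_sup C).
apply: (jF _ (cover F)) (meet_convex_bigcap mF SF) (join_convex_cover jF SF) _ _ => //.
exact: subset_trans sub2 (subsetUr _ _).
Qed.

(** [F] is the union of at most [k] cells. *)
Definition has_cells d k F := exists P,
  [/\ #|P| <= k, (forall D, D \in P -> cell d D) & cover P = F].

Lemma upper_dim_le P :
  (forall D, D \in P -> join_convex D) -> upper_dim (cover P) <= #|P|.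
Proof.
move=> cP; set F := cover P; set G := cover @: (P :\ set0).
have topP D : D \in P :\ set0 -> cover D \in D.
  rewrite !inE => /andP[/set0Pn[S SD] /cP jD].
  exact: join_convex_cover jD SD.
have subF D : D \in P -> D \subset F by move=> DP; exact: bigcup_sup DP.
suff domG : dominates G F.
  rewrite /upper_dim; case: arg_minnP => [|G' _ /(_ _ domG) leG'].
    exact: dominates_refl.
  apply: leq_trans leG' _; apply: leq_trans (leq_imset_card _ _) _.
  by rewrite subset_leq_card // subsetDl.
have GF : G \subset F.
  apply/subsetP => _ /imsetP[D DP ->]; apply: (subsetP (subF D _)) (topP D DP).
  by case/setD1P: DP.
rewrite /dominates GF /=; apply/existsP.
(* The largest convex part of [F] with greatest element [A]: it contains all
   the cells with union [A] at once, so distinct cells may share [A]. *)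
exists [ffun A : {set X} =>
  [set S in F | (S \subset A) && (set_itv S A \subset F)]].
apply/andP; split.
  apply/forall_inP => A AG; rewrite ffunE; set E := [set _ in _ | _].
  have AF := subsetP GF A AG.
  have AE : A \in E by rewrite inE AF subxx set_itvxx sub1set.
  have covE : cover E = A.
    apply/eqP; rewrite eqEsubset (bigcup_sup A) // andbT.
    by apply/bigcupsP => S; rewrite inE => /and3P[].
  rewrite /dominated covE AE eqxx andbT /=; apply/convex_familyP => S T C.
  rewrite !inE => /and3P[_ SA /subsetP SAF] /and3P[_ TA _] SC CT.
  have CA := subset_trans CT TA; rewrite CA /= SAF ?mem_set_itv ?SC //=.
  apply/subsetP => B; rewrite mem_set_itv => /andP[CB BA].
  by rewrite SAF // mem_set_itv BA (subset_trans SC).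
apply/eqP/setP => S; apply/bigcupP/idP => [[A _]|SF].
  by rewrite ffunE inE => /and3P[].
have /bigcupP[D DP SD] := SF.
have DP0 : D \in P :\ set0.
  by rewrite !inE DP andbT; apply/set0Pn; exists S.
exists (cover D); first exact: imset_f.
rewrite ffunE inE SF (bigcup_sup S) //=; apply/subsetP => C.
rewrite mem_set_itv => /andP[SC CD]; apply: (subsetP (subF D DP)).
apply: (cP D DP S (cover D)) => //; first exact: topP.
exact: subset_trans CD (subsetUr _ _).
Qed.

Lemma dual_upper_dim_le P :
  (forall D, D \in P -> meet_convex D) -> dual_upper_dim (cover P) <= #|P|.
Proof.
move=> cP; set F := cover P.
pose core D := \bigcap_(A in D) A; set G := core @: (P :\ set0).
have botP D : D \in P :\ set0 -> core D \in D.
  rewrite !inE => /andP[/set0Pn[S SD] /cP mD].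
  exact: meet_convex_bigcap mD SD.
have subF D : D \in P -> D \subset F by move=> DP; exact: bigcup_sup DP.
suff supG : supports G F.
  rewrite /dual_upper_dim; case: arg_minnP => [|G' _ /(_ _ supG) leG'].
    exact: supports_refl.
  apply: leq_trans leG' _; apply: leq_trans (leq_imset_card _ _) _.
  by rewrite subset_leq_card // subsetDl.
have GF : G \subset F.
  apply/subsetP => _ /imsetP[D DP ->]; apply: (subsetP (subF D _)) (botP D DP).
  by case/setD1P: DP.
rewrite /supports GF /=; apply/existsP.
(* The largest convex part of [F] with least element [A]. *)
exists [ffun A : {set X} =>
  [set S in F | (A \subset S) && (set_itv A S \subset F)]].
apply/andP; split.
  apply/forall_inP => A AG; rewrite ffunE; set E := [set _ in _ | _].
  have AF := subsetP GF A AG.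
  have AE : A \in E by rewrite inE AF subxx set_itvxx sub1set.
  have capE : \bigcap_(B in E) B = A.
    apply/eqP; rewrite eqEsubset (bigcap_inf A) //=.
    by apply/bigcapsP => S; rewrite inE => /and3P[].
  have E0 : E != set0 by apply/set0Pn; exists A.
  rewrite /supported capE AE E0 eqxx !andbT /=; apply/convex_familyP => S T C.
  rewrite !inE => /and3P[_ AS _] /and3P[_ AT /subsetP ATF] SC CT.
  have subAC := subset_trans AS SC; rewrite subAC /= ATF ?mem_set_itv ?subAC //=.
  apply/subsetP => B; rewrite mem_set_itv => /andP[AB BC].
  by rewrite ATF // mem_set_itv AB (subset_trans BC).
apply/eqP/setP => S; apply/bigcupP/idP => [[A _]|SF].
  by rewrite ffunE inE => /and3P[].
have /bigcupP[D DP SD] := SF.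
have DP0 : D \in P :\ set0.
  by rewrite !inE DP andbT; apply/set0Pn; exists S.
exists (core D); first exact: imset_f.
rewrite ffunE inE SF (bigcap_inf S) //=; apply/subsetP => C.
rewrite mem_set_itv => /andP[DC CS]; apply: (subsetP (subF D DP)).
apply: (cP D DP S (core D)) => //; first exact: botP.
exact: subset_trans (subsetIr _ _) DC.
Qed.

Lemma cylindrical_dim_le P :
  (forall D, D \in P -> join_convex D /\ meet_convex D) ->
  cylindrical_dim (cover P) <= #|P|.
Proof.
move=> cP; pose P' := P :\ set0.
have P'P : #|P'| <= #|P| by rewrite subset_leq_card // subsetDl.
rewrite /cylindrical_dim; case: ex_minnP => k _ /(_ #|P'|) lek.
apply: leq_trans P'P; apply: lek; apply/existsP.
exists [ffun i => enum_val i]; apply/andP; split.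
  apply/forallP => i; rewrite ffunE; have := enum_valP i.
  by rewrite !inE => /andP[D0 /cP[]]; exact: cell_interval.
apply/eqP/setP => S; apply/bigcupP/bigcupP => [[D DP SD]|[i _]].
  have DP' : D \in P' by rewrite !inE DP andbT; apply/set0Pn; exists S.
  by exists (enum_rank_in DP' D) => //; rewrite ffunE enum_rankK_in.
by rewrite ffunE => Si; exists (enum_val i) => //; case/setD1P: (enum_valP i).
Qed.

Lemma dim_leP d k F : dim d F <= k <-> has_cells d k F.
Proof.
split=> [|[P [Pk cP <-]]]; last first.
  apply: leq_trans Pk; case: d cP => cP.
  - exact: upper_dim_le.
  - exact: dual_upper_dim_le.
  - exact: cylindrical_dim_le.
case: d => /=.
- rewrite /upper_dim; case: arg_minnP => [|G + _ Gk]; first exact: dominates_refl.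
  case/andP=> _ /existsP[D /andP[/forall_inP DG /eqP DF]].
  exists (D @: G); split; rewrite ?(leq_trans (leq_imset_card _ _)) //.
    move=> _ /imsetP[A AG ->]; have /and3P[dD cD _] := DG A AG.
    exact: convex_dominated_join_convex.
  by rewrite cover_imset.
- rewrite /dual_upper_dim; case: arg_minnP => [|G + _ Gk]; first exact: supports_refl.
  case/andP=> _ /existsP[D /andP[/forall_inP DG /eqP DF]].
  exists (D @: G); split; rewrite ?(leq_trans (leq_imset_card _ _)) //.
    move=> _ /imsetP[A AG ->]; have /and3P[dD cD _] := DG A AG.
    exact: convex_supported_meet_convex.
  by rewrite cover_imset.
- rewrite /cylindrical_dim; case: ex_minnP => m + _ mk.
  case/existsP=> I /andP[/forallP II /eqP->].
  exists (I @: 'I_m); split; rewrite ?(leq_trans (leq_imset_card _ _)) ?card_ord //.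
    by move=> _ /imsetP[i _ ->]; exact: interval_cell.
  by rewrite cover_imset.
Qed.

End Cells.

(** * Local operators *)

Section LocalOperator.
Variables (X Y : finType) (p : Y -> X) (K : X -> pred {set Y}).
Implicit Types F : {set {set Y}}.

(** The sets [T] with a witness in [F]: a member of [F] that lies over [T] and
whose part over each [u] in [T] satisfies [K u]. *)
Definition local_op F : {set {set X}} :=
  [set T : {set X} | [exists T' : {set Y} in F, (p @: T' \subset T) &&
    [forall u in T, K u (T' :&: p @^-1: [set u])]]].

Lemma local_opP F (T : {set X}) : reflect
  (exists T' : {set Y}, [/\ T' \in F, forall t, t \in T' -> p t \in T &
    forall u, u \in T -> K u (T' :&: p @^-1: [set u])])
  (T \in local_op F).
Proof.
rewrite inE; apply: (iffP exists_inP) => [[T' T'F /andP[pT /forall_inP KT]]|].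
  exists T'; split=> // t tT'; apply: (subsetP pT); exact: imset_f.
case=> T' [T'F pT KT]; exists T' => //; apply/andP; split.
  by apply/subsetP => _ /imsetP[t tT' ->]; exact: pT.
exact/forall_inP.
Qed.

Lemma local_op_join_convex F : join_convex F -> join_convex (local_op F).
Proof.
move=> jF S T C /local_opP[S' [SF pS KS]] /local_opP[T' [TF pT KT]] SC CST.
(* Keep the witness of [S] over [S], and use that of [T] over the rest of [C]. *)
apply/local_opP; exists (S' :|: (T' :&: p @^-1: (C :\: S))); split.
- apply: (jF S' T') => //; first exact: subsetUl.
  by rewrite setUS // subsetIl.
- move=> t; rewrite !inE => /orP[/pS/(subsetP SC)//|].
  by case/and3P.
- move=> u uC; have [uS|uS] := boolP (u \in S).
    suff -> : (S' :|: T' :&: p @^-1: (C :\: S)) :&: p @^-1: [set u]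
              = S' :&: p @^-1: [set u] by exact: KS.
    apply/setP => t; rewrite !inE; have [->|] := eqVneq (p t) u.
      by rewrite uS !andbF orbF.
    by rewrite !andbF.
  have uT : u \in T by have := subsetP CST u uC; rewrite inE (negPf uS).
  suff -> : (S' :|: T' :&: p @^-1: (C :\: S)) :&: p @^-1: [set u]
            = T' :&: p @^-1: [set u] by exact: KT.
  apply/setP => t; rewrite !inE; have [ptu|] := eqVneq (p t) u; last first.
    by rewrite !andbF.
  rewrite ptu uC uS !andbT; case tS: (t \in S') => //=.
  by have := pS t tS; rewrite ptu (negPf uS).
Qed.

Lemma local_op_meet_convex F : meet_convex F -> meet_convex (local_op F).
Proof.
move=> mF S T C /local_opP[S' [SF pS KS]] /local_opP[T' [TF pT KT]] STC CS.
(* The common part of the two witnesses lies over [S :&: T], hence over [C]. *)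
apply/local_opP; exists (S' :&: p @^-1: C); split.
- apply: (mF S' T') => //; last exact: subsetIl.
  apply/subsetP => t; rewrite !inE => /andP[tS tT].
  by rewrite tS (subsetP STC) // inE pS // pT.
- by move=> t; rewrite !inE => /andP[].
- move=> u uC; have uS := subsetP CS u uC.
  suff -> : (S' :&: p @^-1: C) :&: p @^-1: [set u] = S' :&: p @^-1: [set u].
    exact: KS.
  apply/setP => t; rewrite !inE; have [->|] := eqVneq (p t) u.
    by rewrite uC andbT.
  by rewrite !andbF.
Qed.

Lemma local_op_cell d F : cell d F -> cell d (local_op F).
Proof.
case: d => [||[jF mF]]; first exact: local_op_join_convex.
  exact: local_op_meet_convex.
by split; [exact: local_op_join_convex|exact: local_op_meet_convex].
Qed.

Lemma local_op_cover (P : {set {set {set Y}}}) :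
  local_op (cover P) = cover (local_op @: P).
Proof.
rewrite cover_imset; apply/setP => T; apply/local_opP/bigcupP.
  case=> T' [/bigcupP[D DP T'D] pT KT]; exists D => //.
  by apply/local_opP; exists T'.
case=> D DP /local_opP[T' [T'D pT KT]]; exists T'; split=> //.
by apply/bigcupP; exists D.
Qed.

Lemma dim_local_op d F : dim d (local_op F) <= dim d F.
Proof.
have /dim_leP[P [Pk cP eP]] := leqnn (dim d F).
apply/dim_leP; exists (local_op @: P); split.
- exact: leq_trans (leq_imset_card _ _) Pk.
- by move=> _ /imsetP[D /cP cD ->]; exact: local_op_cell.
- by rewrite -eP local_op_cover.
Qed.

End LocalOperator.

(** * Disjoint sums, intersections and unions of families *)

Section SumFamily.
Variables X Y : finType.
Implicit Types (F : {set {set X}}) (G : {set {set Y}}).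

(** The disjoint sums of a member of [F] and a member of [G]. *)
Definition sum_family F G : {set {set X + Y}} :=
  [set W : {set X + Y} | (inl @^-1: W \in F) && (inr @^-1: W \in G)].

Lemma sum_family_join_convex F G :
  join_convex F -> join_convex G -> join_convex (sum_family F G).
Proof.
move=> jF jG S T C; rewrite !inE => /andP[SF SG] /andP[TF TG] SC CST.
rewrite (jF _ _ _ SF TF) ?(jG _ _ _ SG TG) -?preimsetU //; exact: preimsetS.
Qed.

Lemma sum_family_meet_convex F G :
  meet_convex F -> meet_convex G -> meet_convex (sum_family F G).
Proof.
move=> mF mG S T C; rewrite !inE => /andP[SF SG] /andP[TF TG] STC CS.
rewrite (mF _ _ _ SF TF) ?(mG _ _ _ SG TG) -?preimsetI //; exact: preimsetS.
Qed.

Lemma sum_family_cell d F G : cell d F -> cell d G -> cell d (sum_family F G).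
Proof.
case: d => [||[jF mF] [jG mG]]; first exact: sum_family_join_convex.
  exact: sum_family_meet_convex.
by split; [exact: sum_family_join_convex|exact: sum_family_meet_convex].
Qed.

Lemma sum_family_cover P Q :
  sum_family (cover P) (cover Q)
  = cover [set sum_family D E | D in P, E in Q].
Proof.
apply/setP => W; apply/idP/bigcupP.
  rewrite inE => /andP[/bigcupP[D DP WD] /bigcupP[E EQ WE]].
  by exists (sum_family D E); [exact: imset2_f|rewrite inE WD].
case=> _ /imset2P[D E DP EQ ->]; rewrite !inE => /andP[WD WE].
by apply/andP; split; apply/bigcupP; [exists D|exists E].
Qed.

Lemma dim_sum_family d F G : dim d (sum_family F G) <= dim d F * dim d G.
Proof.
have /dim_leP[P [Pk cP eP]] := leqnn (dim d F).
have /dim_leP[Q [Qk cQ eQ]] := leqnn (dim d G).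
apply/dim_leP; exists [set sum_family D E | D in P, E in Q]; split.
- rewrite curry_imset2X; apply: leq_trans (leq_imset_card _ _) _.
  by rewrite cardsX; exact: leq_mul.
- by move=> _ /imset2P[D E /cP cD /cQ cE ->]; exact: sum_family_cell.
- by rewrite -eP -eQ sum_family_cover.
Qed.

End SumFamily.
Section BinaryOperators.
Variable X : finType.
Implicit Types F G : {set {set X}}.

(** The folding map, along which both binary operations are local. *)
Definition untag_sum (w : X + X) : X := match w with inl u | inr u => u end.

Lemma local_op_setI F G :
  local_op untag_sum (fun u W => (inl u \in W) && (inr u \in W))
    (sum_family F G) = F :&: G.
Proof.
apply/setP => T; apply/local_opP/setIP => [[W []]|[TF TG]].
  rewrite inE => /andP[WF WG] pW KW.
  have eT b : (if b then inl else inr) @^-1: W = T.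
    apply/setP => u; rewrite inE; apply/idP/idP => [/pW|/KW].
      by case: b.
    by rewrite !inE => /andP[/andP[? _] /andP[? _]]; case: b.
  by rewrite -{1}(eT true) -(eT false).
exists (untag_sum @^-1: T); split.
- have eT i : cancel i untag_sum -> i @^-1: (untag_sum @^-1: T) = T.
    by move=> iK; apply/setP => u; rewrite !inE iK.
  by rewrite inE !eT ?TF.
- by move=> w; rewrite inE.
- by move=> u uT; rewrite !inE /= uT eqxx.
Qed.

Lemma local_op_setU F G :
  local_op untag_sum (fun u W => (inl u \in W) || (inr u \in W))
    (sum_family F G) = [set U :|: V | U in F, V in G].
Proof.
apply/setP => T; apply/local_opP/imset2P => [[W []]|[U V UF VG ->]].
  rewrite inE => /andP[WF WG] pW KW.
  exists (inl @^-1: W) (inr @^-1: W) => //; apply/setP => u; rewrite !inE.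
  apply/idP/orP => [/KW|[/pW|/pW]//].
  by rewrite !inE => /orP[/andP[uW _]|/andP[uW _]]; [left|right].
exists [set w | match w with inl u => u \in U | inr u => u \in V end]; split.
- rewrite inE; set W := [set _ | _].
  have eU : inl @^-1: W = U by apply/setP => u; rewrite !inE.
  have eV : inr @^-1: W = V by apply/setP => u; rewrite !inE.
  by rewrite eU eV UF.
- by case=> u; rewrite !inE => ->; rewrite ?orbT.
- by move=> u; rewrite !inE /= eqxx !andbT.
Qed.

Lemma dim_setI d F G : dim d (F :&: G) <= dim d F * dim d G.
Proof.
rewrite -local_op_setI.
exact: leq_trans (dim_local_op _ _ _ _) (dim_sum_family _ _ _).
Qed.

Lemma dim_setU d F G :
  dim d [set U :|: V | U in F, V in G] <= dim d F * dim d G.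
Proof.
rewrite -local_op_setU.
exact: leq_trans (dim_local_op _ _ _ _) (dim_sum_family _ _ _).
Qed.

End BinaryOperators.

(** * Assignments and teams as tuples and sets of tuples *)

Section Assignments.
Variable A : finType.
Implicit Types (s : assignment A) (k : nat).

Local Notation assign x t := (update [fmap]%fmap x t).

Variable a0 : A.

Lemma fnd_update s (y : seq nat) (b : seq A) k : size b = size y ->
  (update s y b).[? k]%fmap =
    if k \in y then Some (nth a0 b (index k y)) else s.[? k]%fmap.
Proof.
elim: y b => [|v y IH] [|a b] //= [sz].
rewrite fnd_set in_cons (eq_sym v); have [//|kv] := eqVneq k v.
by rewrite IH.
Qed.

Lemma domf_update s (y : seq nat) (b : seq A) k : size b = size y ->
  (k \in domf (update s y b)) = (k \in domf s) || (k \in y).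
Proof.
move=> sz; rewrite -!fndSome fnd_update //.
by case: (k \in y); rewrite ?orbT ?orbF.
Qed.

(** The values of [s] at the variables [x]; [a0] stands for missing values. *)
Definition tabulate n s (x : n.-tuple nat) : n.-tuple A :=
  [tuple of [seq odflt a0 s.[? k]%fmap | k <- x]].

Lemma fnd_update_tabulate n s s' (y : n.-tuple nat) k :
  (update s y (tabulate s' y)).[? k]%fmap =
    if k \in (y : seq nat) then Some (odflt a0 s'.[? k]%fmap)
    else s.[? k]%fmap.
Proof.
rewrite fnd_update ?size_map //; case: ifP => // ky.
by rewrite (nth_map k) ?index_mem // nth_index.
Qed.

Lemma assign_tabulate n s (x : n.-tuple nat) :
  (forall k, (k \in domf s) = (k \in (x : seq nat))) ->
  assign x (tabulate s x) = s.
Proof.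
move=> sx; apply/fmapP => k; rewrite fnd_update_tabulate -sx fnd_fmap0.
by case: fndP.
Qed.

Lemma tabulate_update n s (y : n.-tuple nat) (b : n.-tuple A) :
  uniq y -> tabulate (update s y b) y = b.
Proof.
move=> uy; apply: val_inj; apply: (@eq_from_nth _ a0) => /=.
  by rewrite size_map !size_tuple.
move=> i; rewrite size_map => iy; rewrite (nth_map 0) //.
by rewrite fnd_update ?size_tuple // mem_nth // index_uniq.
Qed.

Lemma tabulate_update_disjoint m n s (z : m.-tuple nat) (y : n.-tuple nat)
    (b : n.-tuple A) : {in z, forall k, k \notin (y : seq nat)} ->
  tabulate (update s y b) z = tabulate s z.
Proof.
move=> zy; apply: val_inj; apply/eq_in_map => k kz.
by rewrite fnd_update ?size_tuple // (negPf (zy k kz)).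
Qed.

Lemma assign_inj n (x : n.-tuple nat) :
  uniq x -> injective (fun t : n.-tuple A => assign x t).
Proof.
by move=> ux t t' /= e; rewrite -(tabulate_update [fmap]%fmap t ux) e
  tabulate_update.
Qed.

Lemma team_ofP (x : seq nat) (T : {set (size x).-tuple A}) s :
  reflect (exists2 t, t \in T & s = assign x t) (s \in team_of T).
Proof. exact: imfsetP. Qed.

Lemma mem_team_of (x : seq nat) (T : {set (size x).-tuple A})
    (t : (size x).-tuple A) :
  uniq x -> (assign x t \in team_of T) = (t \in T).
Proof.
move=> ux; apply/team_ofP/idP => [[t' t'T e]|tT]; last by exists t.
by rewrite (@assign_inj _ (in_tuple x) ux _ _ e).
Qed.

Lemma team_of_subset (x : seq nat) (T : {set (size x).-tuple A}) (U : team A) :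
  (U `<=` team_of T)%fset ->
  team_of [set t : (size x).-tuple A | assign x t \in U] = U.
Proof.
move=> /fsubsetP UT; apply/fsetP => s; apply/team_ofP/idP => [[t]|sU].
  by rewrite inE => tU ->.
by have /team_ofP[t _ e] := UT s sU; exists t; rewrite ?inE -?e.
Qed.

Lemma team_ofU (x : seq nat) (U V : {set (size x).-tuple A}) :
  team_of (U :|: V) = (team_of U `|` team_of V)%fset.
Proof.
apply/fsetP => s; rewrite in_fsetU.
apply/team_ofP/orP => [[t /setUP[tU|tV] ->]|[]/team_ofP[t tU ->]].
- by left; apply/team_ofP; exists t.
- by right; apply/team_ofP; exists t.
- by exists t; rewrite // inE tU.
- by exists t; rewrite // inE tU orbT.
Qed.

Section Split.
Variables (r : nat) (x z : seq nat) (y : r.-tuple nat).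
Hypotheses (ux : uniq x) (zyx : perm_eq (z ++ y) x).

(** [join_tuple] and [proj_tuple] identify the tuples over [x] with the pairs
of a tuple over [z] and a tuple over [y], when the variables [x] are distinct
and [z ++ y] is a permutation of [x].
Both pass through assignments, so that no index bookkeeping is needed. *)
Definition join_tuple (u : (size z).-tuple A) (w : r.-tuple A) :
    (size x).-tuple A :=
  tabulate (update (assign z u) y w) (in_tuple x).

Definition proj_tuple (t : (size x).-tuple A) : (size z).-tuple A :=
  tabulate (assign x t) (in_tuple z).

Let uzy : uniq (z ++ y). Proof. by rewrite (perm_uniq zyx). Qed.
Let uz : uniq z. Proof. by have := uzy; rewrite cat_uniq => /and3P[]. Qed.
Let uy : uniq y. Proof. by have := uzy; rewrite cat_uniq => /and3P[]. Qed.
Let zNy : {in z, forall k, k \notin (y : seq nat)}.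
Proof.
move=> k kz; apply: contraL uzy => ky; rewrite cat_uniq negb_and negb_and.
by apply/orP; right; apply/orP; left; rewrite negbK; apply/hasP; exists k.
Qed.

Lemma assign_join u w :
  assign x (join_tuple u w) = update (assign z u) y w.
Proof.
apply: (@assign_tabulate _ _ (in_tuple x)) => k /=.
rewrite !domf_update ?size_tuple // domf0 in_fset0 /=.
by rewrite -(perm_mem zyx) mem_cat.
Qed.

Lemma proj_join u w : proj_tuple (join_tuple u w) = u.
Proof.
rewrite /proj_tuple assign_join tabulate_update_disjoint //.
exact: (@tabulate_update _ _ (in_tuple z)).
Qed.

Lemma join_tuple_inj u : injective (join_tuple u).
Proof.
move=> w w' e; have := assign_join u w; rewrite e assign_join => e'.
by rewrite -(tabulate_update (assign z u) w uy) -e' tabulate_update.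
Qed.

Lemma join_proj t : exists w, t = join_tuple (proj_tuple t) w.
Proof.
exists (tabulate (assign x t) y); apply: (@assign_inj _ (in_tuple x) ux).
rewrite [RHS]assign_join; apply/fmapP => k.
rewrite fnd_update_tabulate (fnd_update_tabulate _ _ (in_tuple z)) /=.
rewrite fnd_fmap0.
have dt : (k \in domf (assign x t)) = (k \in z) || (k \in (y : seq nat)).
  by rewrite domf_update ?size_tuple // domf0 in_fset0 -(perm_mem zyx) mem_cat.
move: dt; case: fndP => [kt|kNt]; first by case: ifP => // _; rewrite orbF => <-.
by move=> /esym/negbT; rewrite negb_or => /andP[/negPf-> /negPf->].
Qed.

Lemma supplement_team_of (T : {set (size z).-tuple A})
    (F : assignment A -> {set r.-tuple A}) :
  supplement (team_of T) F y =
  team_of [set join_tuple u w | u in T, w in F (assign z u)].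
Proof.
apply/fsetP => s; apply/imfset2P/team_ofP.
  case=> _ /team_ofP[u uT ->] [w wF ->].
  by exists (join_tuple u w); [exact: imset2_f|rewrite assign_join].
case=> _ /imset2P[u w uT wF ->] ->; exists (assign z u).
  by apply/team_ofP; exists u.
by exists w; rewrite ?assign_join.
Qed.

End Split.
End Assignments.
(** * The logical operations on extensions *)

Section Extensions.
Variables (tau : vocabulary) (L : team_logic tau) (M : model tau).
Implicit Types (phi psi : formula L) (x z : seq nat).

Lemma extension_And phi psi x :
  extension (And phi psi) M x = extension phi M x :&: extension psi M x.
Proof. by apply/setP => T; rewrite !inE -asbool_and. Qed.

Lemma model_inhabited : exists a : M, a \in M.
Proof. by apply/card_gt0P; apply: ltnW (card_carrier M). Qed.

Lemma extension_Or phi psi x : uniq x ->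
  extension (Or phi psi) M x =
  [set U :|: V | U in extension phi M x, V in extension psi M x].
Proof.
move=> ux; have [a0 _] := model_inhabited.
apply/setP => T; rewrite inE; apply/asboolP/imset2P => /=; last first.
  case=> U V; rewrite !inE => /asboolP Uphi /asboolP Vpsi ->.
  by exists (team_of U), (team_of V); rewrite team_ofU.
case=> U [V [TUV Uphi Vpsi]].
pose tuples (W : team M) :=
  [set t : (size x).-tuple M | update [fmap]%fmap x t \in W].
have eU : team_of (tuples U) = U.
  by apply: (team_of_subset (T := T)); rewrite TUV fsubsetUl.
have eV : team_of (tuples V) = V.
  by apply: (team_of_subset (T := T)); rewrite TUV fsubsetUr.
exists (tuples U) (tuples V); rewrite ?inE ?eU ?eV; try exact/asboolP.
by apply/setP => t; rewrite !inE -in_fsetU -TUV (mem_team_of a0).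
Qed.

(** The extension over [z] of the formula that quantifies [y] in [phi] by the
quantifier whose relations on the carrier of [M] are those satisfying [P]. *)
Definition quantifier_extension r (P : {set r.-tuple M} -> Prop)
    (y : r.-tuple nat) phi z : {set {set (size z).-tuple M}} :=
  [set T : {set (size z).-tuple M} |
    `[< exists F : assignment M -> {set r.-tuple M},
      (forall s, s \in team_of T -> P (F s)) /\
      sat (supplement (team_of T) F y) phi >]].

Lemma dim_quantifier_extension d phi x z r (y : r.-tuple nat)
    (P : {set r.-tuple M} -> Prop) : uniq x -> perm_eq (z ++ y) x ->
  dim d (quantifier_extension P y phi z) <= dim d (extension phi M x).
Proof.
move=> ux zyx; have [a0 _] := model_inhabited.
pose assign (t : (size z).-tuple M) := update [fmap]%fmap z t.
pose join := @join_tuple _ a0 r x z y; pose proj := @proj_tuple _ a0 x z.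
have uz : uniq z by move: ux; rewrite -(perm_uniq zyx) cat_uniq => /and3P[].
have assign_inj : injective assign := @assign_inj _ a0 _ (in_tuple z) uz.
have joinK u w : proj (join u w) = u by exact: proj_join.
pose fiber u (W : {set (size x).-tuple M}) := [set w | join u w \in W].
have fiberI u W : fiber u (W :&: proj @^-1: [set u]) = fiber u W.
  by apply/setP => w; rewrite !inE joinK eqxx andbT.
(* The supplementing function is read off the fibers of a witness, and
   conversely its graph is a witness. *)
suff -> : quantifier_extension P y phi z =
    local_op proj (fun u W => `[< P (fiber u W) >]) (extension phi M x).
  exact: dim_local_op.
apply/setP => T; rewrite inE; apply/asboolP/local_opP.
  case=> F [PF satF]; exists [set join u w | u in T, w in F (assign u)].
  split=> [|_ /imset2P[u w uT _ ->]|u uT]; last 2 first.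
  - by rewrite joinK.
  - apply/asboolP; rewrite fiberI.
    suff -> : fiber u [set join u w | u in T, w in F (assign u)] = F (assign u).
      by apply: PF; rewrite (mem_team_of a0).
    apply/setP => w; rewrite inE; apply/imset2P/idP => [|wF]; last by exists u w.
    case=> u' w' _ + e; have := congr1 proj e; rewrite !joinK => eu.
    by move: e; rewrite -eu => /(join_tuple_inj ux zyx)->.
  by rewrite inE; apply/asboolP; rewrite -supplement_team_of.
case=> T' []; rewrite inE => /asboolP satT' pT KT.
pose F s := [set w | [exists u, (assign u == s) && (join u w \in T')]].
have eF u : F (assign u) = fiber u T'.
  apply/setP => w; rewrite !inE; apply/existsP/idP => [[u' /andP[/eqP e]]|uw].
    by rewrite (assign_inj _ _ e).
  by exists u; rewrite eqxx.
exists F; split=> [_ /team_ofP[u uT ->]|].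
  by rewrite -/(assign u) eF -fiberI; apply/asboolP/KT.
rewrite (supplement_team_of a0 zyx).
suff -> : [set join u w | u in T, w in F (assign u)] = T' by [].
apply/setP => t; apply/imset2P/idP => [[u w _ + ->]|tT'].
  by rewrite eF inE.
have [w e] := join_proj a0 ux zyx t.
exists (proj t) w => //; first exact: pT.
by rewrite eF inE -[join _ _]e.
Qed.

Lemma dim_extension_And d phi psi x :
  dim d (extension (And phi psi) M x)
  <= dim d (extension phi M x) * dim d (extension psi M x).
Proof. by rewrite extension_And dim_setI. Qed.

Lemma dim_extension_Or d phi psi x : uniq x ->
  dim d (extension (Or phi psi) M x)
  <= dim d (extension phi M x) * dim d (extension psi M x).
Proof. by move=> ux; rewrite extension_Or // dim_setU. Qed.

Lemma dim_extension_Lind d phi x z (Q : lindstrom) (y : (arity Q).-tuple nat) :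
  uniq x -> perm_eq (z ++ y) x ->
  dim d (extension (Lind y phi) M z) <= dim d (extension phi M x).
Proof.
move=> ux zyx.
exact: (@dim_quantifier_extension d phi x z _ y (@lclass Q M) ux zyx).
Qed.

Lemma tuple1_thead (A : Type) (t : 1.-tuple A) : [tuple thead t] = t.
Proof. by case/tupleP: t => a t; apply: val_inj; rewrite (tuple0 t). Qed.

(** Quantifying one variable is quantifying a tuple of length one. *)
Lemma supplement1E (T : team M) (F : assignment M -> {set M}) v :
  supplement1 T F v =
  supplement T (fun s => [set t : 1.-tuple M | thead t \in F s]) [tuple v].
Proof.
apply/fsetP => s; apply/imfset2P/imfset2P => -[s' s'T [a aF ->]].
  by exists s' => //; exists [tuple a] => //; rewrite inE.
exists s' => //; exists (thead a); first by rewrite inE in aF.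
by rewrite -[a in LHS]tuple1_thead.
Qed.

Lemma perm_rem_cat1 (x : seq nat) v : v \in x -> perm_eq (rem v x ++ [:: v]) x.
Proof.
by move=> vx; rewrite perm_sym (perm_trans (perm_to_rem vx)) // -cat1s perm_catC.
Qed.

Lemma dim_extension_Ex d phi x v : uniq x -> v \in x ->
  dim d (extension (Ex v phi) M (rem v x)) <= dim d (extension phi M x).
Proof.
move=> ux vx.
have zyx : perm_eq (rem v x ++ [tuple v]) x by exact: perm_rem_cat1.
have := @dim_quantifier_extension d phi x _ _ _ (fun W => W != set0) ux zyx.
congr (dim d _ <= _); apply/setP => T; rewrite !inE; apply/asboolP/asboolP => /=.
  case=> F [F0 satF]; exists (fun s => [set a | [tuple a] \in F s]); split.
    move=> s /F0/set0Pn[t tF]; apply/set0Pn; exists (thead t).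
    by rewrite inE tuple1_thead.
  rewrite supplement1E; move: satF; congr sat; congr supplement.
  by apply/funext => s; apply/setP => t; rewrite !inE tuple1_thead.
case=> F [F0 satF]; rewrite supplement1E in satF; eexists; split; last exact: satF.
move=> s /F0/set0Pn[a aF]; apply/set0Pn; exists [tuple a].
by rewrite inE.
Qed.

Lemma dim_extension_All d phi x v : uniq x -> v \in x ->
  dim d (extension (All v phi) M (rem v x)) <= dim d (extension phi M x).
Proof.
move=> ux vx.
have zyx : perm_eq (rem v x ++ [tuple v]) x by exact: perm_rem_cat1.
have := @dim_quantifier_extension d phi x _ _ _ (fun W => W = setT) ux zyx.
congr (dim d _ <= _); apply/setP => T; rewrite !inE; apply/asboolP/asboolP => /=.
  case=> F [FT satF]; rewrite /duplicate supplement1E; move: satF; congr sat.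
  apply/fsetP => s; apply/imfset2P/imfset2P => -[s' s'T [t tF ->]].
    by exists s' => //; exists t; rewrite ?inE.
  by exists s' => //; exists t; rewrite ?(FT s') ?inE.
rewrite /duplicate supplement1E => satT; eexists; split; last exact: satT.
by move=> s _; apply/setP => t; rewrite !inE.
Qed.

End Extensions.

(** * Growth classes *)

Lemma shuffle_perm_eq x z l y : shuffle x z l y -> perm_eq (z ++ y) x.
Proof.
case=> ul /allP lx -> ->; rewrite -map_cat.
rewrite -[X in perm_eq _ X](mkseq_nth 0) perm_map //.
apply: uniq_perm; rewrite ?iota_uniq //.
  rewrite cat_uniq ul filter_uniq ?iota_uniq // andbT /=.
  by apply/hasPn => i il; rewrite mem_filter il.
move=> i; rewrite mem_cat mem_filter mem_iota /=.
by case: (boolP (i \in l)) => //= [/lx->|_]; rewrite ?orbF.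
Qed.

Section Growth.
Variables (tau : vocabulary) (L : team_logic tau) (O : set (nat -> nat)).
Hypothesis HO : growth_class O.
Variable d : dim_kind.

Lemma dim_dim_fun (phi : formula L) (M : model tau) x :
  dim d (extension phi M x) <= dim_fun d phi x #|M|.
Proof. by move: (leqnn (dim_fun d phi x #|M|)) => /dim_fun_leP; apply. Qed.

Lemma growth_unary (phi psi : formula L) x z :
  (forall M, dim d (extension psi M z) <= dim d (extension phi M x)) ->
  O (dim_fun d phi x) -> O (dim_fun d psi z).
Proof.
case: HO => O_le _ _ le Ophi; apply: O_le Ophi _ => n.
by apply/dim_fun_leP => M <-; apply: leq_trans (le M) (dim_dim_fun _ _ _).
Qed.

Lemma growth_binary (phi psi theta : formula L) x :
  (forall M, dim d (extension theta M x)
     <= dim d (extension phi M x) * dim d (extension psi M x)) ->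
  O (dim_fun d phi x) -> O (dim_fun d psi x) -> O (dim_fun d theta x).
Proof.
case: HO => O_le _ O_mul le Ophi Opsi; apply: O_le (O_mul _ _ Ophi Opsi) _ => n.
apply/dim_fun_leP => M <-; apply: leq_trans (le M) _.
by apply: leq_mul; exact: dim_dim_fun.
Qed.

End Growth.

Theorem corollary4p22 (O : set (nat -> nat)) (HO : growth_class O)
  (d : dim_kind) (tau : vocabulary) (L : team_logic tau)
  (phi psi : formula L) (x : seq nat) (Hx : uniq x)
  (Hphi : {subset fv phi <= x}) (Hpsi : {subset fv psi <= x}) :
  [/\ (O (dim_fun d phi x) -> O (dim_fun d psi x) ->
         O (dim_fun d (And phi psi) x)),
      (O (dim_fun d phi x) -> O (dim_fun d psi x) ->
         O (dim_fun d (Or phi psi) x)),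
      (forall v, v \in x -> O (dim_fun d phi x) ->
         O (dim_fun d (Ex v phi) (rem v x)) /\
         O (dim_fun d (All v phi) (rem v x)))
    & (forall (Q : lindstrom) (z l : seq nat) (y : (arity Q).-tuple nat),
         shuffle x z l y -> O (dim_fun d phi x) ->
         O (dim_fun d (Lind y phi) z))].
Proof.
split.
- by apply: growth_binary => // M; exact: dim_extension_And.
- by apply: growth_binary => // M; exact: dim_extension_Or.
- move=> v vx Ophi; split; apply: growth_unary Ophi => // M.
    exact: dim_extension_Ex.
  exact: dim_extension_All.
- move=> Q z l y /shuffle_perm_eq zyx; apply: growth_unary => // M.
  exact: dim_extension_Lind.
Qed.
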